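(* Suppose $\Vert\mathcal{A}\bm{x}^\star\Vert\neq0$ and $\Vert\bm{\lambda}^\star\Vert\neq0$. Set $\bm{\zeta}^0=\bm{0}$ and choose the step-size $\rho=\rho^\star=\pm\sqrt{\Vert\bm{\lambda}^\star\Vert/\Vert\mathcal{A}\bm{x}^\star\Vert}$ (either sign). Let $$\theta=\arccos\frac{\langle\mathcal{A}\bm{x}^\star,\bm{\lambda}^\star\rangle}{\Vert\mathcal{A}\bm{x}^\star\Vert\,\Vert\bm{\lambda}^\star\Vert}.$$ Then the ADMM iterates satisfy, for all $k=0,1,2,\dots$, $$\frac{\Vert\mathcal{A}\bm{x}^{k+2}-\mathcal{A}\bm{x}^{k+1}\Vert^2}{\Vert\mathcal{A}\bm{x}^\star\Vert^2}\le\frac{2}{k+1}(1+\cos\theta),$$ $$\frac{\Vert\bm{\lambda}^{k+1}-\bm{\lambda}^{k}\Vert^2}{\Vert\bm{\lambda}^\star\Vert^2}\le\frac{2}{k+1}(1+\cos\theta),$$ $$\frac{\Vert\bm{\zeta}^{k+1}-\bm{\zeta}^{k}\Vert^2}{\Vert\mathcal{A}\bm{x}^\star\Vert\,\Vert\bm{\lambda}^\star\Vert}\le\frac{2}{k+1}(1+\cos\theta).$$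
   Context: $\mathbb{H},\mathbb{P},\mathbb{K}$ are real Hilbert spaces; $\Gamma_0(\cdot)$ denotes convex, closed, proper functions with values in $(-\infty,+\infty]$. Consider: minimize $f(\bm{x})+g(\bm{z})$ subject to $\mathcal{A}\bm{x}-\mathcal{B}\bm{z}=\bm{c}$, with $f\in\Gamma_0(\mathbb{H})$, $g\in\Gamma_0(\mathbb{P})$, $\bm{c}\in\mathbb{K}$, and $\mathcal{A}:\mathbb{H}\to\mathbb{K}$, $\mathcal{B}:\mathbb{P}\to\mathbb{K}$ injective bounded linear. A solution is assumed to exist: $\bm{x}^\star,\bm{z}^\star$ are optimal and $\bm{\lambda}^\star\in\mathbb{K}$ is an optimal Lagrange multiplier (i.e. $(\bm{x}^\star,\bm{z}^\star,\bm{\lambda}^\star)$ is a saddle point of $f(\bm{x})+g(\bm{z})+\langle\bm{\lambda},\mathcal{A}\bm{x}-\mathcal{B}\bm{z}-\bm{c}\rangle$). For a fixed domain step-size $\rho\neq0$ (classical step-size $\gamma=\rho^2$), ADMM iterates, for $k=0,1,\dots$: $$\bm{x}^{k+1}=\mathrm{argmin}_{\bm{x}}\,f(\bm{x})+\tfrac12\Vert\rho(\mathcal{A}\bm{x}-\mathcal{B}\bm{z}^k-\bm{c})+\bm{\lambda}^k/\rho\Vert^2,$$ $$\bm{z}^{k+1}=\mathrm{argmin}_{\bm{z}}\,g(\bm{z})+\tfrac12\Vert\rho(\mathcal{A}\bm{x}^{k+1}-\mathcal{B}\bm{z}-\bm{c})+\bm{\lambda}^k/\rho\Vert^2,$$ $$\bm{\lambda}^{k+1}=\bm{\lambda}^k+\rho^2(\mathcal{A}\bm{x}^{k+1}-\mathcal{B}\bm{z}^{k+1}-\bm{c}).$$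 All minimizers are understood to exist. The fixed-point variable is $\bm{\zeta}^{k+1}=\rho\mathcal{A}\bm{x}^{k+1}+\bm{\lambda}^k/\rho$, and the iteration is a fixed-point iteration in $\bm{\zeta}$. Initializing at $\bm{\zeta}^0\in\mathbb{K}$ means $\bm{z}^0=\mathrm{argmin}_{\bm{z}}\,g(\bm{z})+\frac12\Vert\rho\mathcal{B}\bm{z}+\rho\bm{c}-\bm{\zeta}^0\Vert^2$ and $\bm{\lambda}^0=\rho\bm{\zeta}^0-\rho^2(\mathcal{B}\bm{z}^0+\bm{c})$, the same relations that hold between $\bm{\zeta}^k$ and $(\bm{z}^k,\bm{\lambda}^k)$ for every $k\ge1$. *)

(* Defs.v *)
From HB Require Import structures.
From mathcomp Require Import all_boot all_order all_algebra.
From mathcomp Require Import all_classical all_reals all_analysis.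

Set Implicit Arguments.
Unset Strict Implicit.
Unset Printing Implicit Defensive.

Import Order.TTheory GRing.Theory Num.Theory.
Import numFieldNormedType.Exports.

Local Open Scope classical_set_scope.
Local Open Scope ring_scope.

HB.mixin Record CompleteNormedModule_isHilbert (R : realType) H
    of CompleteNormedModule R H := {
  inner : {dot H for (@idfun R)} ;
  inner_norm : forall x : H, inner x x = `|x| ^+ 2
}.

#[short(type="hilbertType")]
HB.structure Definition Hilbert (R : realType) :=
  {H of CompleteNormedModule R H & CompleteNormedModule_isHilbert R H}.

Section convex_analysis.
Context {R : realType}.
Local Open Scope ereal_scope.

(* In \bar R, [0 * +oo = 0], so the end points t = 0 and t = 1 are harmless. *)
Definition convex_efun (E : lmodType R) (f : E -> \bar R) :=
  forall (t : R) (x y : E), (0 <= t <= 1)%R ->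
    f (t *: x + (1 - t) *: y)%R <= t%:E * f x + (1 - t)%:E * f y.

Definition proper_efun (E : Type) (f : E -> \bar R) :=
  (forall x, f x != -oo) /\ (exists x, f x != +oo).

Definition Gamma0 (E : normedModType R) : set (E -> \bar R) :=
  [set f | [/\ convex_efun f, lower_semicontinuous f & proper_efun f]].

Definition argmin (E : Type) (F : E -> \bar R) : set E :=
  [set x | forall y, F x <= F y].

Definition bounded_linear_injection (E F : normedModType R)
    (A : {linear E -> F}) :=
  bounded_near A (nbhs (0%R : E)) /\ injective A.

End convex_analysis.

Section admm.
Context {R : realType} {H P K : hilbertType R}.
Variables (f : H -> \bar R) (g : P -> \bar R).
Variables (A : {linear H -> K}) (B : {linear P -> K}) (c : K).

Definition optimal (x : H) (z : P) :=
  A x - B z = c /\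
  forall x' z', A x' - B z' = c -> (f x + g z <= f x' + g z')%E.

Definition lagrangian (x : H) (z : P) (l : K) : \bar R :=
  (f x + g z + (inner l (A x - B z - c))%:E)%E.

Definition saddle_point (x : H) (z : P) (l : K) :=
  (forall l', (lagrangian x z l' <= lagrangian x z l)%E) /\
  (forall x' z', (lagrangian x z l <= lagrangian x' z' l)%E).

(* The entry [x 0] plays no role: the x-iterates start at index 1. *)
Record admm (rho : R) (zeta0 : K)
    (x : nat -> H) (z : nat -> P) (lambda zeta : nat -> K) : Prop := Admm {
  admm_zeta0 : zeta 0%N = zeta0 ;
  admm_z0 : argmin (fun z' : P =>
    (g z' + (2^-1 * `|rho *: B z' + rho *: c - zeta0| ^+ 2)%:E)%E) (z 0%N) ;
  admm_lambda0 :
    lambda 0%N = rho *: zeta0 - rho ^+ 2 *: (B (z 0%N) + c) ;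
  admm_xS : forall k : nat, argmin (fun x' : H =>
    (f x' + (2^-1 * `|rho *: (A x' - B (z k) - c)
                      + rho^-1 *: lambda k| ^+ 2)%:E)%E) (x k.+1) ;
  admm_zS : forall k : nat, argmin (fun z' : P =>
    (g z' + (2^-1 * `|rho *: (A (x k.+1) - B z' - c)
                      + rho^-1 *: lambda k| ^+ 2)%:E)%E) (z k.+1) ;
  admm_lambdaS : forall k : nat, lambda k.+1 =
    lambda k + rho ^+ 2 *: (A (x k.+1) - B (z k.+1) - c) ;
  admm_zetaS : forall k : nat, zeta k.+1 =
    rho *: A (x k.+1) + rho^-1 *: lambda k
}.

End admm.

(* Main.v *)
(* ADMM is Douglas-Rachford splitting in zeta. Put q = rho (B z + c),
   m = lambda / rho and p = rho A x^+, so that zeta = q + m and zeta^+ = p + m.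
   The optimality conditions of the two subproblems are subgradient relations;
   monotonicity of subgradients gives, for the differences of two runs,
   <q, m> >= 0 and <p, q - m - p> >= 0. Hence |p| and |m| are bounded by
   |q + m|, and zeta |-> zeta^+ is firmly nonexpansive. A saddle point is a
   fixed point zeta* = rho A x* + lambda* / rho, so |zeta^(k+1) - zeta^k|^2 is
   nonincreasing with sum at most |zeta^0 - zeta*|^2. With zeta^0 = 0 and
   rho^2 = |lambda*| / |A x*|, the latter is
   2 |A x*| |lambda*| (1 + cos theta). *)
Require Import Defs.
From HB Require Import structures.
From mathcomp Require Import all_boot all_order all_algebra.
From mathcomp Require Import all_classical all_reals all_analysis.
From mathcomp Require Import ring lra.

Set Implicit Arguments.
Unset Strict Implicit.
Unset Printing Implicit Defensive.

Import Order.TTheory GRing.Theory Num.Theory.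
Import numFieldNormedType.Exports.

Local Open Scope classical_set_scope.
Local Open Scope ring_scope.

Lemma subrDr (V : zmodType) (u v w : V) : (u + w) - (v + w) = u - v.
Proof. by rewrite opprD addrACA subrr addr0. Qed.

(** * The real inner product and its norm *)

Section inner_product.
Context {R : realType} {K : hilbertType R}.
Implicit Types (u v w : K) (a : R).

Lemma innerC u v : inner u v = inner v u.
Proof. by rewrite hermC expr0 mul1r. Qed.

Lemma innerDl u v w : inner (u + v) w = inner u w + inner v w.
Proof. by rewrite linearDl. Qed.

Lemma innerDr u v w : inner u (v + w) = inner u v + inner u w.
Proof. by rewrite linearDr. Qed.

Lemma innerNl u v : inner (- u) v = - inner u v.
Proof. by rewrite linearNl. Qed.

Lemma innerNr u v : inner u (- v) = - inner u v.
Proof. by rewrite linearNr. Qed.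

Lemma innerZl a u v : inner (a *: u) v = a * inner u v.
Proof. by rewrite linearZl_LR. Qed.

Lemma innerZr a u v : inner u (a *: v) = a * inner u v.
Proof. by rewrite innerC innerZl innerC. Qed.

Definition innerE :=
  (innerDl, innerDr, innerNl, innerNr, innerZl, innerZr).

Lemma normD_sqr u v : `|u + v| ^+ 2 = `|u| ^+ 2 + 2 * inner u v + `|v| ^+ 2.
Proof. by rewrite -!inner_norm !innerE (innerC v u); ring. Qed.

(** Squaring the triangle inequality and expanding bounds [inner u v] from above; applying this to
    [- u] gives the lower bound. *)
Lemma cauchy_schwarz u v : `|inner u v| <= `|u| * `|v|.
Proof.
have le_inner w : inner w v <= `|w| * `|v|.
  have : `|w + v| ^+ 2 <= (`|w| + `|v|) ^+ 2.
    by rewrite lerXn2r ?nnegrE ?addr_ge0 ?ler_normD.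
  by rewrite normD_sqr; lra.
by rewrite ler_norml le_inner lerNl -innerNl -(normrN u) le_inner.
Qed.

End inner_product.

(** * First-order optimality and monotonicity of subgradients *)

Section subgradient.
Context {R : realType} {E : lmodType R} {K : hilbertType R}.
Variables (F : E -> \bar R) (L : {linear E -> K}).

(* The adjoint of [L] applied to [n] is a subgradient of [F] at [x]. *)
Definition subgrad (n : K) (x : E) :=
  F x \is a fin_num /\ forall y, (F x + (inner n (L y - L x))%:E <= F y)%E.

Lemma subgrad_monotone n1 n2 x1 x2 :
  subgrad n1 x1 -> subgrad n2 x2 -> 0 <= inner (n1 - n2) (L x1 - L x2).
Proof.
move=> [f1 F1] [f2 F2]; move: (F1 x2) (F2 x1).
by rewrite -(fineK f1) -(fineK f2) -!EFinD !lee_fin !innerE; lra.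
Qed.

(** The map [h] is affine with linear part [r *: L], so the quadratic has gradient [r *: h x] seen
    through [L]. On the segment from [x] to [y], convexity and minimality give [0 <= s + t * D / 2],
    where [s] is the slope at [x]; small [t] forces [0 <= s]. *)
Lemma argmin_subgrad (h : E -> K) (r : R) (x : E) :
  convex_efun F -> proper_efun F ->
  (forall y, h y - h x = r *: (L y - L x)) ->
  argmin (fun y => F y + (2^-1 * `|h y| ^+ 2)%:E)%E x ->
  subgrad (- (r *: h x)) x.
Proof.
move=> cvxF [NyF [y0 y0F]] hE xmin.
have fin_le y : F y != +oo%E -> F y \is a fin_num.
  by move=> Fy; rewrite fin_numE NyF.
have Fx : F x \is a fin_num.
  (* An infinite value at the minimizer would exceed the finite value at [y0]. *)
  apply: (fin_le x); apply/eqP => Fxy; have := xmin y0.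
  by rewrite Fxy -(fineK (fin_le _ y0F)) -EFinD.
split=> // y; have [->|/fin_le Fy] := eqVneq (F y) +oo%E; first exact: leey.
rewrite -(fineK Fx) -(fineK Fy) -EFinD lee_fin.
set a := fine (F x); set b := fine (F y).
set d := L y - L x; set D := `|r *: d| ^+ 2.
have D_ge0 : 0 <= D by exact: sqr_ge0.
set s := b - a + inner (h x) (r *: d).
have le_t t : 0 < t <= 1 -> 0 <= s + 2^-1 * t * D.
  move=> /andP[t0 t1]; set w := t *: y + (1 - t) *: x.
  have Fw : (F w <= (t * b + (1 - t) * a)%:E)%E.
    have := cvxF t y x; rewrite -(fineK Fx) -(fineK Fy) -!EFinM -EFinD.
    by apply; rewrite t1 ltW.
  have := le_trans (xmin w) (leeD2r _ Fw).
  have -> : h w = h x + t *: (r *: d).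
    have Lw : L w - L x = t *: d.
      rewrite /w linearD [L (t *: y)]linearZ [L ((1 - t) *: x)]linearZ /=.
      by rewrite scalerBl scale1r scalerBr addrA addrAC addrK.
    by apply/eqP; rewrite addrC -subr_eq hE Lw !scalerA mulrC.
  rewrite -(fineK Fx) -/a -!EFinD lee_fin normD_sqr innerZr normrZ exprMn.
  rewrite -normrX (ger0_norm (sqr_ge0 t)) -/D => le_at.
  by rewrite -(pmulr_rge0 _ t0) /s; lra.
suff s_ge0 : 0 <= s.
  by move: s_ge0; rewrite /s !innerE; lra.
(* [t = - s / (D - s)] contradicts [le_t] if the slope [s] is negative. *)
rewrite leNgt; apply/negP => s0.
have Ds0 : 0 < D - s by lra.
have := le_t (- s / (D - s)).
have -> : s + 2^-1 * (- s / (D - s)) * D = s / (D - s) * (2^-1 * D - s).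
  by field; apply/eqP; lra.
rewrite divr_gt0 ?oppr_gt0 //= ler_pdivrMr // mul1r => /(_ ltac:(lra)).
by rewrite leNgt pmulr_llt0 ?pmulr_llt0 ?invr_gt0 ?s0 //; lra.
Qed.

End subgradient.

(** * Norm inequalities of Douglas-Rachford splitting and the resulting rate *)

Section firmly_nonexpansive.
Context {R : realType} {K : hilbertType R}.

(** The second hypothesis gives [|p| <= |q - m|], and the first gives [|q - m| <= |q + m|]. In the
    last inequality the gap is exactly twice the sum of the two hypotheses. *)
Lemma douglas_rachford_norm_le (p q m : K) :
    0 <= inner q m -> 0 <= inner p (q - m - p) ->
  [/\ `|p| ^+ 2 <= `|q + m| ^+ 2, `|m| ^+ 2 <= `|q + m| ^+ 2
    & `|p + m| ^+ 2 + `|p - q| ^+ 2 <= `|q + m| ^+ 2].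
Proof.
move=> qm; rewrite !innerE inner_norm => pqm.
have := sqr_ge0 `|q|; have := sqr_ge0 `|p|.
have := sqr_ge0 `|p - (q - m)|; rewrite !normD_sqr !normrN !innerE.
rewrite normD_sqr normrN innerNr => le1 le2 le3.
by split; lra.
Qed.

Lemma fejer_rate (u : nat -> K) (us : K) (k : nat) :
    (forall i, `|u i.+1 - us| ^+ 2 + `|u i.+1 - u i| ^+ 2
               <= `|u i - us| ^+ 2) ->
    (forall i, `|u i.+2 - u i.+1| ^+ 2 <= `|u i.+1 - u i| ^+ 2) ->
  k.+1%:R * `|u k.+1 - u k| ^+ 2 <= `|u 0%N - us| ^+ 2.
Proof.
move=> fejer decr.
(* Keeping the distance to [us] on the left makes the sum telescope by induction; the latest step,
   being the shortest, is counted [k.+1] times. *)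
suff : `|u k.+1 - us| ^+ 2 + k.+1%:R * `|u k.+1 - u k| ^+ 2
    <= `|u 0%N - us| ^+ 2.
  by apply: le_trans; rewrite lerDr sqr_ge0.
elim: k => [|k]; first by rewrite mul1r.
apply: le_trans; have := fejer k.+1.
have : k.+1%:R * `|u k.+2 - u k.+1| ^+ 2 <= k.+1%:R * `|u k.+1 - u k| ^+ 2.
  by rewrite ler_wpM2l.
by rewrite [k.+2%:R]mulrS; lra.
Qed.

End firmly_nonexpansive.

(** * Contraction estimates for a pair of ADMM states *)

Section admm_state.
Context {R : realType} {H P K : hilbertType R}.
Variables (f : H -> \bar R) (g : P -> \bar R).
Variables (A : {linear H -> K}) (B : {linear P -> K}) (c : K) (rho : R).

(* By the optimality conditions of the subproblems, this holds of
   [(x k.+1, z k, lambda k)]: the new [x], but the old [z] and [lambda]. *)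
Definition admm_state (x : H) (z : P) (l : K) :=
  subgrad g B l z /\ subgrad f A (- (rho ^+ 2 *: (A x - B z - c) + l)) x.

Definition zeta_of (z : P) (l : K) := rho *: (B z + c) + rho^-1 *: l.
Definition zeta_next (x : H) (l : K) := rho *: A x + rho^-1 *: l.

(** The constant [c] cancels in differences, so monotonicity for [g] and [f] supplies the two
    Douglas-Rachford hypotheses. It serves both for two successive iterates and for an iterate
    against the saddle point. *)
Lemma admm_state_nonexpansive (x1 x2 : H) (z1 z2 : P) (l1 l2 : K) :
    rho != 0 -> admm_state x1 z1 l1 -> admm_state x2 z2 l2 ->
    let Delta := zeta_of z1 l1 - zeta_of z2 l2 in
    let Delta' := zeta_next x1 l1 - zeta_next x2 l2 in
  [/\ rho ^+ 2 * `|A x1 - A x2| ^+ 2 <= `|Delta| ^+ 2,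
      rho ^- 2 * `|l1 - l2| ^+ 2 <= `|Delta| ^+ 2
    & `|Delta'| ^+ 2 + `|Delta' - Delta| ^+ 2 <= `|Delta| ^+ 2].
Proof.
move=> rho0 [g1 f1] [g2 f2] Delta Delta'.
have gm := subgrad_monotone g1 g2; have fm := subgrad_monotone f1 f2.
pose p := rho *: (A x1 - A x2); pose q := rho *: (B z1 - B z2).
pose m := rho^-1 *: (l1 - l2).
have DE : Delta = q + m.
  rewrite /Delta /zeta_of opprD addrACA -!scalerBr.
  by rewrite subrDr.
have D'E : Delta' = p + m.
  by rewrite /Delta' /zeta_next opprD addrACA -!scalerBr.
have qm : 0 <= inner q m.
  by rewrite innerZl innerZr mulrA divff // mul1r innerC.
have pqm : 0 <= inner p (q - m - p).
  suff -> : inner p (q - m - p) = inner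
     (- (rho ^+ 2 *: (A x1 - B z1 - c) + l1)
       - - (rho ^+ 2 *: (A x2 - B z2 - c) + l2)) (A x1 - A x2) by [].
  by rewrite innerC /p /q /m !innerE; field.
have [p_le m_le pm_le] := douglas_rachford_norm_le qm pqm.
have -> : Delta' - Delta = p - q by rewrite DE D'E subrDr.
rewrite {}DE {}D'E; split=> //.
- by move: p_le; rewrite /p normrZ exprMn real_normK ?num_real.
- by move: m_le; rewrite {1}/m normrZ exprMn real_normK ?num_real // exprVn.
Qed.

End admm_state.

(** * The saddle point and the iterates as ADMM states *)

Section admm_iterates.
Context {R : realType} {H P K : hilbertType R}.
Variables (f : H -> \bar R) (g : P -> \bar R).
Variables (A : {linear H -> K}) (B : {linear P -> K}) (c : K) (rho : R).
Hypotheses (f_Gamma0 : Gamma0 f) (g_Gamma0 : Gamma0 g) (rho0 : rho != 0).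

(** Minimizing the Lagrangian in one variable, with the other kept at the saddle point, gives each
    subgradient relation. Feasibility removes the [rho] term, so any [rho] is allowed. *)
Lemma saddle_point_state xs zs ls :
  A xs - B zs = c -> saddle_point f g A B c xs zs ls ->
  admm_state f g A B c rho xs zs ls.
Proof.
move=> feas [_ saddle]; case: f_Gamma0 => _ _ [Nyf [x0 x0f]].
case: g_Gamma0 => _ _ [Nyg [z0 z0g]].
have fin_f x : f x != +oo%E -> f x \is a fin_num by rewrite fin_numE Nyf.
have fin_g z : g z != +oo%E -> g z \is a fin_num by rewrite fin_numE Nyg.
have [fxs gzs] : f xs \is a fin_num /\ g zs \is a fin_num.
  have := saddle x0 z0; rewrite /lagrangian.
  rewrite -(fineK (fin_f _ x0f)) -(fineK (fin_g _ z0g)) -!EFinD.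
  have := Nyf xs; have := Nyg zs.
  by case: (f xs) (g zs) => [a||] [b||].
split; split=> //.
- move=> z; have [->|/fin_g gz] := eqVneq (g z) +oo%E; first exact: leey.
  move: (saddle xs z); rewrite /lagrangian.
  rewrite -(fineK fxs) -(fineK gzs) -(fineK gz).
  by rewrite -!EFinD !lee_fin !innerE; lra.
- move=> x; have [->|/fin_f fx] := eqVneq (f x) +oo%E; first exact: leey.
  rewrite feas subrr scaler0 add0r.
  move: (saddle x zs); rewrite /lagrangian.
  rewrite -(fineK fxs) -(fineK gzs) -(fineK fx).
  by rewrite -!EFinD !lee_fin !innerE; lra.
Qed.

Variables (x : nat -> H) (z : nat -> P) (lambda zeta : nat -> K) (zeta0 : K).
Hypothesis iterates : admm f g A B c rho zeta0 x z lambda zeta.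

(** For [k = 0] this inverts the initialization of [lambda]; afterwards the multiplier update trades
    [A (x k.+1)] for [B (z k.+1) + c]. *)
Lemma admm_zetaE k : zeta k = zeta_of B c rho (z k) (lambda k).
Proof.
case: iterates => z0E _ l0E _ _ lE zE; case: k => [|k].
  rewrite /zeta_of z0E l0E scalerBr !scalerA mulVf // scale1r.
  by rewrite expr2 mulrA mulVf // mul1r addrC subrK.
rewrite /zeta_of zE lE [rho^-1 *: (_ + _)]scalerDr scalerA expr2 mulrA mulVf //.
rewrite mul1r addrCA -scalerDr -[_ - c]addrA -opprD.
by rewrite [_ + (A _ - _)]addrC subrK addrC.
Qed.

Lemma admm_iterate_state k : admm_state f g A B c rho (x k.+1) (z k) (lambda k).
Proof.
case: f_Gamma0 => fcvx _ fproper; case: g_Gamma0 => gcvx _ gproper.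
case: (iterates) => _ z0min l0E xmin zmin lE zE.
split; last first.
  have -> : rho ^+ 2 *: (A (x k.+1) - B (z k) - c) + lambda k =
      rho *: (rho *: (A (x k.+1) - B (z k) - c) + rho^-1 *: lambda k).
    by rewrite [RHS]scalerDr !scalerA divff // scale1r expr2.
  apply: argmin_subgrad (xmin k) => // x'.
  by rewrite subrDr -scalerBr !subrDr.
case: k => [|k].
  have -> : lambda 0%N = - (rho *: (rho *: B (z 0%N) + rho *: c - zeta0)).
    rewrite l0E -scalerDr scalerBr scalerA opprB.
    by rewrite expr2.
  apply: argmin_subgrad z0min => // z'.
  by rewrite !subrDr scalerBr.
(* The residual depends on [z] through [- rho *: B], so the optimality condition is applied with
   [r = - rho]; at the start, [r = rho]. *)
have -> : lambda k.+1 = - (- rho *: (rho *: (A (x k.+1) - B (z k.+1) - c)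
    + rho^-1 *: lambda k)).
  rewrite lE scaleNr opprK [RHS]scalerDr !scalerA divff //.
  by rewrite scale1r expr2 addrC.
apply: argmin_subgrad (zmin k) => // z'.
rewrite subrDr -scalerBr subrDr opprD addrACA subrr add0r -opprD.
by rewrite scalerN scaleNr.
Qed.

End admm_iterates.

Theorem proposition4p1 (R : realType) (H P K : hilbertType R)
  (f : H -> \bar R) (g : P -> \bar R)
  (A : {linear H -> K}) (B : {linear P -> K}) (c : K)
  (xs : H) (zs : P) (ls : K) (rho : R)
  (x : nat -> H) (z : nat -> P) (lambda zeta : nat -> K)
  (f_Gamma0 : Gamma0 f) (g_Gamma0 : Gamma0 g)
  (A_inj : bounded_linear_injection A) (B_inj : bounded_linear_injection B)
  (opt : optimal f g A B c xs zs) (saddle : saddle_point f g A B c xs zs ls)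
  (Axs_neq0 : `|A xs| != 0) (ls_neq0 : `|ls| != 0)
  (rho_star : rho = Num.sqrt (`|ls| / `|A xs|) \/
              rho = - Num.sqrt (`|ls| / `|A xs|))
  (iterates : admm f g A B c rho 0 x z lambda zeta) :
  let theta := acos (inner (A xs) ls / (`|A xs| * `|ls|)) in
  forall k : nat,
  [/\ `|A (x k.+2) - A (x k.+1)| ^+ 2 / `|A xs| ^+ 2
        <= 2 / k.+1%:R * (1 + cos theta),
      `|lambda k.+1 - lambda k| ^+ 2 / `|ls| ^+ 2
        <= 2 / k.+1%:R * (1 + cos theta)
    & `|zeta k.+1 - zeta k| ^+ 2 / (`|A xs| * `|ls|)
        <= 2 / k.+1%:R * (1 + cos theta) ].

Proof.
move=> theta k.
have Axs_gt0 : 0 < `|A xs| by rewrite lt_def Axs_neq0 normr_ge0.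
have ls_gt0 : 0 < `|ls| by rewrite lt_def ls_neq0 normr_ge0.
have rho2 : rho ^+ 2 = `|ls| / `|A xs|.
  have r_ge0 : 0 <= `|ls| / `|A xs| by rewrite divr_ge0.
  by case: rho_star => ->; rewrite ?sqrrN sqr_sqrtr.
have rho0 : rho != 0.
  by rewrite -(sqrf_eq0 rho) rho2 mulf_neq0 ?invr_eq0.
(* Cauchy-Schwarz puts the argument of [acos] in [[-1, 1]]. *)
have cos_theta : cos theta = inner (A xs) ls / (`|A xs| * `|ls|).
  rewrite acosK // in_itv /= -ler_norml normrM normfV normrM !normr_id.
  by rewrite ler_pdivrMr ?mulr_gt0 // mul1r cauchy_schwarz.
have state := admm_iterate_state f_Gamma0 g_Gamma0 rho0 iterates.
have states := saddle_point_state rho f_Gamma0 g_Gamma0 opt.1 saddle.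
pose zs' := zeta_of B c rho zs ls.
(* By feasibility the saddle point is a fixed point of the iteration in [zeta]. *)
have zsE : zeta_next A rho xs ls = zs'.
  by rewrite /zs' /zeta_of -opt.1 [B zs + _]addrC subrK.
have zetaE := admm_zetaE rho0 iterates.
have zetaSE i : zeta i.+1 = zeta_next A rho (x i.+1) (lambda i).
  exact: admm_zetaS iterates i.
(* The chosen step-size balances the two squares: [rho ^+ 2 * |A xs| ^+ 2] and
   [rho ^- 2 * |ls| ^+ 2] both equal [|A xs| * |ls|]. *)
have zs_sqr : `|zs'| ^+ 2 = `|A xs| * `|ls| * (2 * (1 + cos theta)).
  rewrite -zsE normD_sqr !normrZ !exprMn !real_normK ?num_real // exprVn rho2.
  rewrite innerZl innerZr cos_theta; field.
  by rewrite rho0 ls_neq0 Axs_neq0.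
have nonexp i j := admm_state_nonexpansive rho0 (state i) (state j).
have rate : `|zeta k.+1 - zeta k| ^+ 2 <=
    `|A xs| * `|ls| * (2 / k.+1%:R * (1 + cos theta)).
  rewrite -(ler_pM2l (ltr0Sn R k)).
  have -> : k.+1%:R * (`|A xs| * `|ls| * (2 / k.+1%:R * (1 + cos theta))) =
      `|zeta 0%N - zs'| ^+ 2.
    rewrite (admm_zeta0 iterates) sub0r normrN zs_sqr.
    by field; rewrite nat1r pnatr_eq0.
  apply: fejer_rate => i.
    have [_ _] := admm_state_nonexpansive rho0 (state i) states.
    rewrite zsE -zetaE -zetaSE -/zs'; apply: le_trans.
    by rewrite subrDr.
  have [_ _] := nonexp i.+1 i; rewrite -!zetaE -!zetaSE.
  by apply: le_trans; rewrite lerDl sqr_ge0.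
(* State [k] contains [x k.+1] with [lambda k], whence the index shift between the first two
   bounds. *)
have [le1 le2 _] := nonexp k.+1 k.
have rho2_gt0 : 0 < rho ^+ 2 by rewrite rho2 divr_gt0.
split.
- rewrite ler_pdivrMr ?exprn_gt0 // -(ler_pM2l rho2_gt0).
  apply: (le_trans le1); rewrite -!zetaE; apply: (le_trans rate).
  rewrite rho2 le_eqVlt; apply/predU1P; left.
  by field; rewrite nat1r Axs_neq0 pnatr_eq0.
- have irho2_gt0 : 0 < rho ^- 2 by rewrite invr_gt0.
  rewrite ler_pdivrMr ?exprn_gt0 // -(ler_pM2l irho2_gt0).
  apply: (le_trans le2); rewrite -!zetaE; apply: (le_trans rate).
  rewrite rho2 le_eqVlt; apply/predU1P; left.
  by field; rewrite Axs_neq0 ls_neq0 nat1r pnatr_eq0.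
- by rewrite ler_pdivrMr ?mulr_gt0 // mulrC.
Qed.
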